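(* Let $N \ge 3$, let $A_1,\dots,A_m \in \mathbb{R}^{d\times d}$ be symmetric and linearly independent, let $y_1,\dots,y_m\in\mathbb{R}$, and put $\ell(W) = \frac12\sum_{i=1}^m (y_i - \langle A_i, W\rangle)^2$ for $W\in\mathbb{R}^{d\times d}$. For $\alpha>0$ let $W_{\mathrm{deep},\infty}(\alpha)$ be the limiting product matrix of gradient flow on the depth-$N$ factorization initialized at $\alpha I$, as defined in the context. Suppose that the matrices $A_1,\dots,A_m$ commute pairwise. Then, if the limit $\bar W_{\mathrm{deep}} := \lim_{\alpha\to 0^+} W_{\mathrm{deep},\infty}(\alpha)$ exists and is a global optimum of $\min_{W\in\mathcal{S}_+^d}\ell(W)$ with $\ell(\bar W_{\mathrm{deep}})=0$, it holds that $$\bar W_{\mathrm{deep}} \in \operatorname*{argmin}_{W\in\mathcal{S}_+^d,\ \ell(W)=0} \|W\|_*,$$ i.e. $\bar W_{\mathrm{deep}}$ is a global optimum with minimal nuclear norm.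
   Context: $\mathcal{S}_+^d$ is the set of symmetric positive semidefinite matrices in $\mathbb{R}^{d\times d}$; $\langle A,B\rangle = \mathrm{tr}(A^\top B)$; $\|\cdot\|_*$ is the nuclear norm (sum of singular values). Gradient flow on the depth-$N$ factorization: define $\phi(W_1,\dots,W_N) := \ell(W_N W_{N-1}\cdots W_1)$ for $W_1,\dots,W_N\in\mathbb{R}^{d\times d}$. For $\alpha>0$ let $W_1(t),\dots,W_N(t)$, $t\ge 0$, solve $\dot W_j(t) = -\frac{\partial\phi}{\partial W_j}(W_1(t),\dots,W_N(t))$ with $W_j(0)=\alpha I$ for $j=1,\dots,N$. Then $W_{\mathrm{deep},\infty}(\alpha) := \lim_{t\to\infty} W_N(t)W_{N-1}(t)\cdots W_1(t)$. The existence of $\bar W_{\mathrm{deep}}$ is understood to include the existence of the limits $W_{\mathrm{deep},\infty}(\alpha)$. *)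

(* Defs.v *)
From HB Require Import structures.
From mathcomp Require Import all_boot all_order all_algebra.
From mathcomp Require Import all_classical all_reals all_analysis.
From mathcomp Require Import polyrcf.

Set Implicit Arguments.
Unset Strict Implicit.
Unset Printing Implicit Defensive.

Import Order.TTheory GRing.Theory Num.Theory.
Import numFieldNormedType.Exports.

Local Open Scope classical_set_scope.
Local Open Scope ring_scope.

Section Matrices.
Variables (R : realType) (d : nat).
Implicit Types B V : 'M[R]_d.

Definition mxinner B V : R := \tr (B^T *m V).

Definition psd : set 'M[R]_d :=
  [set V | V^T = V /\ forall x : 'cV[R]_d, 0 <= (x^T *m V *m x) 0 0].

(* The singular values of V are the square roots of the eigenvalues of V^T V,
   repeated according to their multiplicity as roots of its characteristic
   polynomial; [rootsR] lists each real root once. *)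
Definition nuclear_norm V : R :=
  let p := char_poly (V^T *m V) in
  \sum_(x <- rootsR p) Num.sqrt x *+ mup x p.

Definition loss (m : nat) (A : 'I_m -> 'M[R]_d) (y : 'I_m -> R) V : R :=
  2^-1 * \sum_(i < m) (y i - mxinner (A i) V) ^+ 2.

End Matrices.

Definition argmin (R : realType) (T : Type) (S : set T) (f : T -> R) : set T :=
  [set x | S x /\ forall z, S z -> f x <= f z].

Section GradientFlow.
Variables (R : realType) (d N : nat).
Implicit Types (W : 'I_N -> 'M[R]_d) (phi : ('I_N -> 'M[R]_d) -> R).

(* The factor W_j of the factorization is indexed by j - 1 : 'I_N, so that the
   ordered product below is W_N *m ... *m W_1. *)
Definition deep_product W : 'M[R]_d :=
  \big[mulmx/1%:M]_(j < N) W (rev_ord j).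

Definition deep_loss (l : 'M[R]_d -> R) W : R := l (deep_product W).

(* The gradient of phi with respect to the block W_j, as the matrix of the
   partial derivatives with respect to its entries. *)
Definition block_grad phi W (j : 'I_N) : 'M[R]_d :=
  \matrix_(a, b)
    'D_(delta_mx a b) (fun X : 'M[R]_d => phi (fun k => if k == j then X else W k))
      (W j).

(* g is the derivative at t of f restricted to [0, +oo[: two-sided for t > 0,
   from the right at t = 0. *)
Definition has_derivative_ge0 (f : R -> 'M[R]_d) (t : R) (g : 'M[R]_d) : Prop :=
  h^-1 *: (f (t + h) - f t) @[h --> within [set h | 0 <= t + h] (0 : R)^'] --> g.

Definition gradient_flow phi (W0 : 'I_N -> 'M[R]_d)
    (W : R -> 'I_N -> 'M[R]_d) : Prop :=
  W 0 = W0 /\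
  forall t, 0 <= t -> forall j,
    has_derivative_ge0 (fun s => W s j) t (- block_grad phi (W t) j).

End GradientFlow.

(* Main.v *)
(** Work in an orthonormal basis diagonalizing all the [A i] at once.  In that
    basis the gradient of the loss is diagonal, so by uniqueness for the flow
    (Gronwall) all factors stay equal to one positive diagonal matrix
    [diag (u_1, ..., u_d)] with [u_k' = mu_k u_k^(N-1)], where the vector [mu]
    lies in the span of the spectra of the [A i].  Hence [\sum_k q_k u_k^(2-N)]
    is constant in time whenever [q] is orthogonal to these spectra.  If [V] is
    another psd solution, [z] the diagonal of [V] and [w] that of the limit
    [Wbar], then [q = z - w] is such a vector, and conservation reads
    [\sum_k (z_k - w_k) (alpha / u_k)^(N-2) = \sum_k (z_k - w_k)].  As time goes
    to infinity and then [alpha] to 0, the terms on the left with [w_k > 0]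
    vanish, because [u_k^N] tends to [w_k], while those with [w_k = 0] are
    nonnegative; so the trace of [Wbar] is at most that of [V].  On psd matrices
    the trace is the nuclear norm. *)

Require Import Defs.
From mathcomp Require Import all_boot all_order all_algebra.
From mathcomp Require Import all_classical all_reals all_analysis.
From mathcomp Require Import polyrcf complex ring lra.
Import Order.TTheory GRing.Theory Num.Theory.
Import numFieldNormedType.Exports.
Local Open Scope classical_set_scope.
Local Open Scope ring_scope.

Set Implicit Arguments.
Unset Strict Implicit.
Unset Printing Implicit Defensive.

(** * Spectral theory of real symmetric matrices *)

Section RealSpectral.
Variable R : rcfType.

(** Over the complex extension the matrix is hermitian, hence unitarily diagonalizable with real
    spectrum; the product of the linear factors of its distinct eigenvalues then annihilates it over
    [R] already. *)
Lemma diagonalizable_sym n (A : 'M[R]_n) : A^T = A -> diagonalizable A.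
Proof.
case: n A => [|n] A Asym.
  by exists 1%:M; [exact: unitmx1|apply/is_diag_mxP; case].
pose f := real_complex R; pose Ac := map_mx f A.
have Aherm : Ac \is hermsymmx.
  apply/is_hermitianmxP; rewrite expr0 scale1r.
  apply/matrixP => i j; rewrite !mxE -[A in LHS]Asym mxE.
  by rewrite (CrealP _) // complex_real.
have /hermitian_normalmx /orthomx_spectralP Aeq := Aherm.
have sp_real := hermitian_spectral_diag_real Aherm.
set sp := spectral_diag Ac in Aeq sp_real.
pose rs := undup [seq complex.Re (sp 0 i) | i <- enum 'I_n.+1].
apply/diagonalizableP; exists rs; first exact: undup_uniq.
rewrite dvd_mxminpoly; apply/eqP/(@map_mx_inj _ _ f).
rewrite map_horner_mx -/Ac Aeq.
rewrite horner_mx_uconjC ?spectral_unit // horner_mx_diag.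
set e := map_mx _ _; suff -> : e = 0 by rewrite linear0 mulmx0 mul0mx map_mx0.
apply/rowP => i; rewrite !mxE; apply/rootP.
have spi : f (complex.Re (sp 0 i)) = sp 0 i.
  have /mxOverP/(_ 0 i) := sp_real.
  by case: (sp 0 i) => a b; rewrite complex_real /= => /eqP ->.
rewrite -spi (fmorph_root f) root_prod_XsubC mem_undup.
by apply/mapP; exists i; rewrite ?mem_enum.
Qed.

Lemma row_dot_ge0 n (v : 'rV[R]_n) : 0 <= (v *m v^T) 0 0.
Proof. by rewrite !mxE sumr_ge0 // => i _; rewrite mxE -expr2 sqr_ge0. Qed.

Lemma row_dot_eq0 n (v : 'rV[R]_n) : (v *m v^T) 0 0 = 0 -> v = 0.
Proof.
rewrite !mxE => /eqP; rewrite psumr_eq0 => [/allP v0|i _]; last first.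
  by rewrite mxE -expr2 sqr_ge0.
apply/rowP => i; have /eqP := v0 i (mem_index_enum _).
by rewrite !mxE => /eqP; rewrite mulf_eq0 orbb => /eqP.
Qed.

(** [Q] is the reflection exchanging the first basis vector and [v], or the identity when they
    coincide. *)
Lemma householder n (v : 'rV[R]_n.+1) : v *m v^T = 1%:M ->
  exists2 Q : 'M[R]_n.+1, Q *m Q^T = 1%:M & delta_mx 0 0 *m Q = v.
Proof.
move=> v1; set e : 'rV[R]_n.+1 := delta_mx 0 0; pose u := e - v.
have [/eqP|u_neq0] := eqVneq u 0.
  rewrite subr_eq0 => /eqP ev.
  by exists 1%:M; rewrite ?trmx1 ?mulmx1.
have e1 : e *m e^T = 1%:M.
  by rewrite trmx_delta mul_delta_mx; apply/matrixP => i j; rewrite !ord1 !mxE.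
have ve : v *m e^T = e *m v^T.
  by apply: trmx_inj; rewrite trmx_mul trmxK !trmx_mul trmxK; apply: trmx_inj;
     apply/matrixP => i j; rewrite !ord1 !mxE; apply: eq_bigr => k _; 
     rewrite !mxE mulrC.
pose c := (u *m u^T) 0 0.
have uu : u *m u^T = c%:M by rewrite [LHS]mx11_scalar.
have c_neq0 : c != 0.
  exact/(contra_neq _ u_neq0)/row_dot_eq0.
(* As [e] and [v] are unit vectors, the squared length of [u = e - v] is twice its inner product
   with [e]. *)
have eu : e *m u^T = (c / 2)%:M.
  have -> : c / 2 = (2^-1 *: (u *m u^T)) 0 0 by rewrite mxE mulrC.
  rewrite -mx11_scalar /u [(e - v)^T]linearB /= !(mulmxBl, mulmxBr) e1 v1 ve.
  by apply/matrixP => i j; rewrite !mxE; field.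
pose Q := 1%:M - (2 / c) *: (u^T *m u).
have QT : Q^T = Q by rewrite linearB linearZ /= trmx_mul trmxK trmx1.
exists Q; last first.
  rewrite mulmxBr mulmx1 -scalemxAr mulmxA eu mul_scalar_mx scalerA.
  have -> : 2 / c * (c / 2) = 1 by field.
  by rewrite scale1r subKr.
have SS : u^T *m u *m (u^T *m u) = c *: (u^T *m u).
  by rewrite mulmxA -[_ *m u *m _]mulmxA uu mul_mx_scalar -scalemxAl.
rewrite QT /Q; move: (u^T *m u) SS => S SS.
rewrite mulmxBl mul1mx mulmxBr mulmx1 -scalemxAl -scalemxAr SS !scalerA.
by apply/matrixP => i j; rewrite !mxE; field.
Qed.

(** Commuting diagonalizable matrices share a basis of eigenvectors; the first row of the change of
    basis is normalized. *)
Lemma sym_common_eigenvector n m (A : 'I_m -> 'M[R]_n.+1) :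
  (forall i, (A i)^T = A i) -> (forall i j, comm_mx (A i) (A j)) ->
  exists2 v : 'rV[R]_n.+1, v *m v^T = 1%:M &
    forall i, exists a, v *m A i = a *: v.
Proof.
move=> Asym Acomm; pose As := [seq A i | i <- enum 'I_m].
have [P Punit /allP Pdiag] : codiagonalizable As.
  apply/codiagonalizableP; split.
    by move=> _ _ /mapP[i _ ->] /mapP[j _ ->]; exact: Acomm.
  by move=> _ /mapP[i _ ->]; exact: diagonalizable_sym.
pose v := row 0 P; pose c := (v *m v^T) 0 0.
have v_neq0 : v != 0.
  apply: contraTneq Punit => v0; apply/negP => /mulmxV P1.
  have := congr1 (row 0) P1; rewrite row_mul -/v v0 mul0mx.
  by move/matrixP/(_ 0 0); rewrite !mxE => /esym/eqP; rewrite oner_eq0.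
have c_gt0 : 0 < c.
  by rewrite lt0r row_dot_ge0 andbT; apply/(contra_neq _ v_neq0)/row_dot_eq0.
exists ((Num.sqrt c)^-1 *: v).
  rewrite linearZ /= -scalemxAl -scalemxAr scalerA [v *m _]mx11_scalar -/c.
  rewrite scale_scalar_mx -invfM -expr2 sqr_sqrtr ?ltW // mulVf //.
  by rewrite gt_eqF.
move=> i; have /similar_diagPex[D] : similar_diag P (A i).
  by apply/Pdiag/mapP; exists i; rewrite ?mem_enum.
move=> /(similarP Punit) PA; exists (D 0 0).
rewrite -scalemxAl /v -row_mul PA row_mul row_diag_mx -scalemxAl -rowE.
by rewrite !scalerA mulrC.
Qed.

(** Induction on the size: a reflection moves a common unit eigenvector to the first axis, symmetry
    splits each matrix into a scalar and a smaller symmetric block, and the smaller blocks still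
    commute. *)
Lemma sym_orthogonal_codiag n m (A : 'I_m -> 'M[R]_n) :
  (forall i, (A i)^T = A i) -> (forall i j, comm_mx (A i) (A j)) ->
  exists2 P : 'M[R]_n, P *m P^T = 1%:M &
    forall i, exists d : 'rV_n, P *m A i *m P^T = diag_mx d.
Proof.
elim: n A => [|n IHn] A Asym Acomm.
  exists 1%:M; first by rewrite trmx1 mulmx1.
  by move=> i; exists 0; apply/matrixP => -[].
have [v v1 vA] := sym_common_eigenvector Asym Acomm.
have [Q Q1 Qv] := householder v1.
have Q2 : Q^T *m Q = 1%:M by apply: mulmx1C.
have [B BE] : exists B : 'I_m -> 'M[R]_(1 + n), forall i, B i = Q *m A i *m Q^T.
  by exists (fun i => Q *m A i *m Q^T).
have Bsym i : (B i)^T = B i.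
  by rewrite BE !trmx_mul trmxK Asym mulmxA.
have Bcomm i j : B i *m B j = B j *m B i.
  have H k l : B k *m B l = Q *m (A k *m A l) *m Q^T.
    rewrite !BE !mulmxA -[X in X *m A l]mulmxA Q2 mulmx1.
    by rewrite -!mulmxA.
  by rewrite !H Acomm.
(* The first row comes from the eigenvector equation, the first column from symmetry. *)
have Brow i : exists a : R, B i = block_mx a%:M 0 0 (drsubmx (B i)).
  have [a va] := vA i; exists a.
  have row0B j : B i (lshift n 0) j = a * (lshift n 0 == j)%:R.
    have -> : lshift n 0 = 0 :> 'I_(1 + n) by apply: val_inj.
    have -> : B i 0 j = row 0 (B i) 0 j by rewrite [RHS]mxE.
    rewrite rowE BE !mulmxA Qv va -Qv -!scalemxAl -mulmxA Q1 mulmx1 !mxE.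
    by rewrite eqxx eq_sym.
  have ur : ursubmx (B i) = 0.
    apply/matrixP => k l; rewrite ord1 !mxE.
    by rewrite row0B eq_lrshift mulr0.
  rewrite -[LHS]submxK ur; congr block_mx; last first.
    by rewrite -[LHS]trmxK trmx_dlsub Bsym ur trmx0.
  apply/matrixP => k l; rewrite !ord1 !mxE.
  by rewrite row0B eqxx mulr1.
have [|i j|P P1 Odiag] := IHn (fun i => drsubmx (B i)).
- by move=> i; rewrite trmx_drsub Bsym.
- have := Bcomm i j; rewrite /comm_mx.
  have [a ->] := Brow i; have [b ->] := Brow j.
  rewrite !mulmx_block !(mul0mx, mulmx0, addr0, add0r).
  by rewrite !block_mxKdr => /eq_block_mx [].
pose K : 'M[R]_(1 + n) := block_mx 1%:M 0 0 P.
have KT : K^T = block_mx 1%:M 0 0 P^T by rewrite tr_block_mx !trmx0 trmx1.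
have KK : K *m K^T = 1%:M.
  rewrite KT mulmx_block !(mul0mx, mulmx0, mulmx1, addr0, add0r) P1.
  by rewrite -scalar_mx_block.
exists (K *m (Q : 'M[R]_(1 + n))).
  by rewrite trmx_mul mulmxA -[_ *m Q *m _]mulmxA Q1 mulmx1.
move=> i; have [d Od] := Odiag i; have [a Ba] := Brow i.
exists (row_mx a%:M d).
have -> : K *m Q *m A i *m (K *m Q)^T = K *m B i *m K^T.
  by rewrite BE trmx_mul !mulmxA.
rewrite Ba KT !mulmx_block.
rewrite !(mul0mx, mulmx0, mulmx1, mul1mx, addr0, add0r) Od.
have aE : a%:M = diag_mx a%:M :> 'M[R]_1.
  by apply/matrixP => k l; rewrite !ord1 !mxE.
by rewrite [RHS](diag_mx_row a%:M d) [in LHS]aE.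
Qed.
End RealSpectral.

(** * The nuclear norm on positive semidefinite matrices *)

Section Nuclear.
Variable R : realType.

Lemma char_poly_orthogonal_conj n (P V : 'M[R]_n) : P *m P^T = 1%:M ->
  char_poly (P *m V *m P^T) = char_poly V.
Proof.
move=> P1; rewrite /char_poly.
have PX1 : map_mx polyC P *m map_mx polyC P^T = 1%:M.
  by rewrite -map_mxM P1 map_mx1.
have -> : char_poly_mx (P *m V *m P^T) =
    map_mx polyC P *m char_poly_mx V *m map_mx polyC P^T.
  rewrite /char_poly_mx mulmxBr mulmxBl !map_mxM mul_mx_scalar -scalemxAl.
  by rewrite PX1 scale_scalar_mx mulr1.
by rewrite !det_mulmx mulrAC -det_mulmx PX1 det1 mul1r.
Qed.

Lemma mxtrace_orthogonal_conj n (P V : 'M[R]_n) : P *m P^T = 1%:M ->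
  \tr (P *m V *m P^T) = \tr V.
Proof. by move=> /mulmx1C P1; rewrite mxtrace_mulC mulmxA P1 mul1mx. Qed.

Lemma psd_conj_diag_ge0 n (P V : 'M[R]_n) k : psd V -> 0 <= (P *m V *m P^T) k k.
Proof.
move=> [_ /(_ (row k P)^T)]; rewrite trmxK.
suff -> : (P *m V *m P^T) k k = (row k P *m V *m (row k P)^T) 0 0 by [].
by rewrite tr_row -row_mul !mxE; apply: eq_bigr => l _; rewrite !mxE.
Qed.

(** Reconciles the encoding of [nuclear_norm], distinct roots weighted by multiplicity, with a list
    of eigenvalues with repetitions. *)
Lemma sum_mup_prod (s : seq R) (f : R -> R) :
  let p := \prod_(x <- s) ('X - x%:P) in
  \sum_(x <- rootsR p) f x *+ mup x p = \sum_(x <- s) f x.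
Proof.
move=> p; have p_neq0 : p != 0 by rewrite monic_neq0 // monic_prod_XsubC.
rewrite -(big_undup_iterop_count _ s xpredT).
rewrite (perm_big (undup s)) /=; last first.
  apply: uniq_perm; rewrite ?undup_uniq ?uniq_roots // => x.
  by rewrite -roots_on_rootsR // in_itv /= root_prod_XsubC mem_undup.
by apply: eq_bigr => x _; rewrite mu_prod_XsubC.
Qed.

(** In a diagonalizing basis the spectrum of [V^T *m V] consists of the squared eigenvalues of [V];
    these eigenvalues being nonnegative, the square roots give them back. *)
Lemma nuclear_norm_psd n (V : 'M[R]_n) : psd V -> nuclear_norm V = \tr V.
Proof.
move=> Vpsd; have [Vsym _] := Vpsd.
have [|i j|P P1 /(_ ord0)[d Vd]] := @sym_orthogonal_codiag R n 1 (fun=> V).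
- by [].
- by [].
rewrite -(mxtrace_orthogonal_conj V P1) Vd mxtrace_diag /nuclear_norm.
have P2 := mulmx1C P1.
have -> : char_poly (V^T *m V) =
    \prod_(x <- [seq d 0 i ^+ 2 | i <- enum 'I_n]) ('X - x%:P).
  rewrite -(char_poly_orthogonal_conj _ P1).
  have -> : P *m (V^T *m V) *m P^T = diag_mx d *m diag_mx d.
    by rewrite Vsym -Vd !mulmxA -[_ *m P^T *m P]mulmxA P2 mulmx1.
  rewrite mulmx_diag char_poly_trig ?diag_mx_is_trig //.
  by rewrite big_map big_enum; apply: eq_bigr => i _; rewrite !mxE eqxx.
rewrite sum_mup_prod big_map big_enum; apply: eq_bigr => i _.
have := psd_conj_diag_ge0 P i Vpsd; rewrite Vd mxE eqxx mulr1n => di.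
by rewrite sqrtr_sqr ger0_norm.
Qed.

End Nuclear.

(** * The gradient of the factorized loss *)

(** The index list is arbitrary, so that the product can be cut at any factor. *)
Definition chain (R : realType) d N (s : seq 'I_N) (W : 'I_N -> 'M[R]_d) :
    'M[R]_d :=
  \big[mulmx/1%:M]_(i <- s) W i.

Lemma chain_cons (R : realType) d N i (s : seq 'I_N) (W : 'I_N -> 'M[R]_d) :
  chain (i :: s) W = W i *m chain s W.
Proof. exact: big_cons. Qed.

Lemma chain_cat (R : realType) d N (s1 s2 : seq 'I_N) (W : 'I_N -> 'M[R]_d) :
  chain (s1 ++ s2) W = chain s1 W *m chain s2 W.
Proof.
elim: s1 => [|i s1 IHs] /=; first by rewrite /chain big_nil mul1mx.
by rewrite !chain_cons IHs mulmxA.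
Qed.

Lemma deep_productE (R : realType) d N (W : 'I_N -> 'M[R]_d) :
  deep_product W = chain [seq rev_ord i | i <- index_enum 'I_N] W.
Proof. by rewrite /chain big_map. Qed.

(** Each index occurs once in the product, so the lists on either side of [j] do not see the
    replaced factor. They are chosen before [W] and hence serve at all times of the flow. *)
Lemma deep_product_split (N : nat) (j : 'I_N) :
  exists s1 s2 : seq 'I_N, (size s1 + size s2).+1 = N /\
  forall (R : realType) d (W : 'I_N -> 'M[R]_d) X,
    deep_product (fun k => if k == j then X else W k) =
    chain s1 W *m X *m chain s2 W.
Proof.
pose s := [seq rev_ord i | i <- index_enum 'I_N].
have s_uniq : uniq s.
  by rewrite map_inj_uniq ?index_enum_uniq //; exact: rev_ord_inj.
have js : j \in s by rewrite -(rev_ordK j) map_f // mem_index_enum.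
have sN : size s = N 
  by rewrite size_map [index_enum _]unlock -enumT size_enum_ord.
have sE : s = [seq rev_ord i | i <- index_enum 'I_N] by [].
clearbody s.
case/splitPr: js s_uniq sN sE => s1 s2; rewrite cat_uniq /= negb_or.
move=> /and3P[_ /andP[js1 _] /andP[js2 _]] sN sE.
exists s1, s2; split=> [|R d W X]; first by rewrite -{3}sN size_cat /= addnS.
have chainX s' : j \notin s' ->
    chain s' (fun k => if k == j then X else W k) = chain s' W.
  move=> js'; rewrite /chain !big_seq; apply: eq_bigr => i is'.
  by case: eqP => // ij; rewrite ij (negPf js') in is'.
by rewrite deep_productE -sE chain_cat chain_cons !chainX // eqxx mulmxA.
Qed.

Definition loss_grad (R : realType) d m (A : 'I_m -> 'M[R]_d) (y : 'I_m -> R)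
    (V : 'M[R]_d) : 'M[R]_d :=
  - \sum_(i < m) (y i - mxinner (A i) V) *: A i.

Section Gradient.
Variables (R : realType) (d m : nat) (A : 'I_m -> 'M[R]_d) (y : 'I_m -> R).

Lemma mxinnerD (B V V' : 'M[R]_d) :
  mxinner B (V + V') = mxinner B V + mxinner B V'.
Proof. by rewrite /mxinner mulmxDr mxtraceD. Qed.

Lemma mxinnerZ (B V : 'M[R]_d) a : mxinner B (a *: V) = a * mxinner B V.
Proof. by rewrite /mxinner -scalemxAr mxtraceZ. Qed.

Lemma mxinner_delta (B : 'M[R]_d) a b : mxinner B (delta_mx a b) = B a b.
Proof.
rewrite /mxinner mxtrace_mulC /mxtrace (bigD1 a) //= big1 ?addr0 => [|i ia].
  rewrite mxE (bigD1 b) //= big1 ?addr0 => [|k kb];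
    rewrite !mxE ?eqxx ?mul1r //.
  by rewrite (negPf kb) andbF mul0r.
by rewrite mxE big1 // => k _; rewrite !mxE (negPf ia) mul0r.
Qed.

Lemma mxinner_mulmx (B L V Q : 'M[R]_d) :
  mxinner B (L *m V *m Q) = mxinner (L^T *m B *m Q^T) V.
Proof.
rewrite /mxinner !trmx_mul !trmxK !mulmxA mxtrace_mulC.
by rewrite !mulmxA.
Qed.

Lemma derive_loss (X E L Q : 'M[R]_d) :
  'D_E (fun X => loss A y (L *m X *m Q)) X =
  mxinner (L^T *m loss_grad A y (L *m X *m Q) *m Q^T) E.
Proof.
rewrite -mxinner_mulmx; set V := L *m X *m Q; set F := L *m E *m Q.
pose p i := y i - mxinner (A i) V; pose e i := mxinner (A i) F.
have -> : mxinner (loss_grad A y V) F = - \sum_i p i * e i.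
  rewrite /mxinner /loss_grad [(- _)^T]linearN /= mulNmx [\tr (- _)]linearN /=.
  rewrite [(\sum_(_ < _) _)^T]linear_sum /= mulmx_suml [\tr _]linear_sum /=.
  congr (- _); apply: eq_bigr => i _.
  by rewrite linearZ /= -scalemxAl mxtraceZ.
rewrite /derive; apply: cvg_lim => //.
(* The loss is quadratic along a line: its expansion is exact, with second-order coefficient [c],
   and the difference quotient is affine in [h]. *)
pose c := 2^-1 * \sum_i e i ^+ 2.
have key h : loss A y (V + h *: F) - loss A y V =
    h * (- \sum_i p i * e i) + h ^+ 2 * c.
  rewrite /loss -mulrBr -sumrB.
  rewrite (eq_bigr (fun i => - (2 * h) * (p i * e i) + h ^+ 2 * e i ^+ 2)).
    by rewrite big_split /= -!mulr_sumr /c; field.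
  by move=> i _; rewrite mxinnerD mxinnerZ -/(e i) /p; ring.
apply: (@cvg_trans _ ((fun h : R => - (\sum_i p i * e i) + h * c) @ 0^')).
  apply: near_eq_cvg; near=> h.
  have h0 : h != 0 by near: h; exact: nbhs_dnbhs_neq.
  rewrite /= /shift /= -/V.
  have -> : L *m (h *: E + X) *m Q = V + h *: F.
    by rewrite mulmxDr mulmxDl -scalemxAr -scalemxAl addrC.
  by rewrite key /GRing.scale /=; field.
have h0 : h @[h --> (0 : R)^'] --> (0 : R) by exact: cvg_within.
have := cvgD (cvg_cst (- \sum_i p i * e i)) (cvgM h0 (cvg_cst c)).
by rewrite mul0r addr0; apply; exact: dnbhs_filter.
Unshelve. all: end_near. Qed.

Lemma block_gradE N (s1 s2 : seq 'I_N) (j : 'I_N) (W : 'I_N -> 'M[R]_d) :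
  (forall X : 'M[R]_d, deep_product (fun k => if k == j then X else W k) =
    chain s1 W *m X *m chain s2 W) ->
  block_grad (deep_loss (loss A y)) W j =
  (chain s1 W)^T *m loss_grad A y (deep_product W) *m (chain s2 W)^T.
Proof.
move=> WX; apply/matrixP => a b; rewrite mxE.
rewrite /deep_loss; under eq_fun do rewrite WX.
rewrite derive_loss mxinner_delta -WX.
have -> : (fun k => if k == j then W j else W k) = W; last by [].
by apply: funext => k; case: eqP => // ->.
Qed.

End Gradient.

(** * The flow in squared time *)

Section Sqr.
Variables (R : realType) (d : nat).

Lemma conj_entryE (P M : 'M[R]_d) a b :
  (P *m M *m P^T) a b = \sum_k \sum_l P a l * M l k * P b k.
Proof.
rewrite mxE; apply: eq_bigr => k _; rewrite !mxE mulr_suml.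
by apply: eq_bigr.
Qed.

Lemma conj_entry_continuous (P : 'M[R]_d) a b :
  continuous (fun M : 'M[R]_d => (P *m M *m P^T) a b).
Proof.
under eq_fun do rewrite conj_entryE.
apply: continuous_big => [|k _]; first exact: add_continuous.
apply: continuous_big => [|l _]; first exact: add_continuous.
move=> M; have Mlk : (fun N : 'M[R]_d => N l k) @ M --> M l k.
  exact: coord_continuous.
exact: (cvgM (cvgM (cvg_cst (P a l)) Mlk) (cvg_cst (P b k))).
Qed.

(* Reparametrizing time by its square makes the flow differentiable on the
   whole real line, including at the origin. *)
Lemma is_derive_conj_sqr (f : R -> 'M[R]_d) (g P : 'M[R]_d) a b (s : R) :
  has_derivative_ge0 f (s ^+ 2) g ->
  is_derive s 1 (fun s => (P *m f (s ^+ 2) *m P^T) a b)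
    (2 * s * (P *m g *m P^T) a b).
Proof.
move=> fg; set F := fun s => _.
suff H : h^-1 *: (F (h *: 1 + s) - F s) @[h --> 0^'] -->
    2 * s * (P *m g *m P^T) a b.
  by apply: DeriveDef; [exact: cvgP H|exact: cvg_lim H].
pose q (k : R) := (P *m (k^-1 *: (f (s ^+ 2 + k) - f (s ^+ 2))) *m P^T) a b.
have qg : q k @[k --> within [set k | 0 <= s ^+ 2 + k] (0 : R)^'] -->
    (P *m g *m P^T) a b.
  exact: (cvg_comp _ _ fg (@conj_entry_continuous P a b g)).
(* The increment of the square: [s ^+ 2 + k h] is [(s + h) ^+ 2], which never leaves the half-line
   where the flow is differentiated. *)
pose k (h : R) := h * (2 * s + h).
have h0 : h @[h --> (0 : R)^'] --> (0 : R) by exact: cvg_within.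
have neq0 : \forall h \near (0 : R)^', 2 * s + h != 0.
  have [->|s0] := eqVneq s 0.
    near=> h; rewrite mulr0 add0r; near: h; exact: nbhs_dnbhs_neq.
  have : 2 * s + h @[h --> (0 : R)^'] --> 2 * s + 0.
    by apply: cvgD => //; exact: cvg_cst.
  rewrite addr0 => /cvgr_neq0; apply.
  by rewrite mulf_neq0.
have kP : k h @[h --> (0 : R)^'] --> within [set k | 0 <= s ^+ 2 + k] (0 : R)^'.
  have k0 : k h @[h --> (0 : R)^'] --> (0 : R).
    rewrite -[X in _ --> X](mul0r (2 * s + 0)); apply: cvgM => //.
    by apply: cvgD => //; exact: cvg_cst.
  have k_neq0 : \forall h \near (0 : R)^', k h != 0.
    near=> h; rewrite mulf_neq0 //; near: h => //; exact: nbhs_dnbhs_neq.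
  move=> B /k0 B0; apply: filterS2 k_neq0 B0 => h kh; apply => //=.
  have -> : s ^+ 2 + k h = (s + h) ^+ 2 by rewrite /k; ring.
  exact: sqr_ge0.
have : (2 * s + h) * q (k h) @[h --> (0 : R)^'] -->
    (2 * s + 0) * (P *m g *m P^T) a b.
  apply: cvgM; last exact: (cvg_comp _ _ kP qg).
  by apply: cvgD => //; exact: cvg_cst.
rewrite addr0; apply: cvg_trans; apply: near_eq_cvg; near=> h.
have h_neq0 : h != 0 by near: h; exact: nbhs_dnbhs_neq.
have sh_neq0 : 2 * s + h != 0 by near: h.
rewrite /= /q /F.
have -> : s ^+ 2 + k h = (h *: 1 + s) ^+ 2 by rewrite /k /GRing.scale /=; ring.
have -> : forall c X Y, (P *m (c *: (X - Y)) *m P^T) a b =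
    c * ((P *m X *m P^T) a b - (P *m Y *m P^T) a b).
  by move=> c X Y; rewrite -scalemxAr -scalemxAl mulmxBr mulmxBl !mxE.
rewrite /k /GRing.scale /=; field.
by rewrite h_neq0 sh_neq0.
Unshelve. all: end_near. Qed.
End Sqr.

(** * Gronwall estimates *)

Section Gronwall.
Variable R : realType.

Lemma is_derive_continuous (f df : R -> R) :
  (forall t : R, is_derive t 1 f (df t)) -> continuous f.
Proof.
move=> fdf t; apply/differentiable_continuous/derivable1_diffP.
by case: (fdf t).
Qed.

Lemma is_derive_bigsum (I : Type) (r : seq I) (f : I -> R -> R) (df : I -> R)
    (t : R) :
  (forall i, is_derive t 1 (f i) (df i)) ->
  is_derive t 1 (fun s => \sum_(i <- r) f i s) (\sum_(i <- r) df i).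
Proof.
move=> fdf; elim: r => [|i r IHr].
  by under eq_fun do rewrite big_nil; rewrite big_nil; exact: is_derive_cst.
under eq_fun do rewrite big_cons; rewrite big_cons.
exact: is_deriveD.
Qed.

Lemma sqr_sum_le (I : finType) (a : I -> R) :
  (\sum_i a i) ^+ 2 <= #|I|%:R * \sum_i a i ^+ 2.
Proof.
rewrite expr2 mulr_suml.
have -> : #|I|%:R * \sum_i a i ^+ 2 =
    \sum_i \sum_j 2^-1 * (a i ^+ 2 + a j ^+ 2).
  set S := \sum_i a i ^+ 2.
  have E i : \sum_j 2^-1 * (a i ^+ 2 + a j ^+ 2) =
      2^-1 * (#|I|%:R * a i ^+ 2 + S).
    by rewrite -mulr_sumr big_split /= sumr_const mulr_natl.
  under [RHS]eq_bigr do rewrite E.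
  rewrite -mulr_sumr big_split /= sumr_const -mulr_sumr -/S -mulr_natl.
  by field.
apply: ler_sum => i _; rewrite mulr_sumr; apply: ler_sum => j _.
by have := sqr_ge0 (a i - a j); lra.
Qed.

(** The function [g t * expR (- c * t)] is nondecreasing on the interval. The bound is from below:
    it yields positivity directly, and uniqueness after a change of sign. *)
Lemma gronwall (g dg : R -> R) (c T : R) : 0 <= T ->
  (forall t : R, is_derive t 1 g (dg t)) ->
  (forall t, 0 <= t <= T -> c * g t <= dg t) ->
  g 0 * expR (c * T) <= g T.
Proof.
move=> T0 gdg cg.
pose h (t : R) := g t * expR (- c * t).
pose dh (t : R) := (dg t - c * g t) * expR (- c * t).
have hdh (t : R) : is_derive t 1 h (dh t).
  rewrite /h; apply: is_derive_eq.
  by rewrite /dh /GRing.scale /=; ring.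
have [t] := MVT_segment T0 (fun t _ => hdh t)
  (continuous_subspaceT (is_derive_continuous hdh)).
rewrite in_itv /= => tT hT.
have : 0 <= h T - h 0.
  by rewrite hT subr0 !mulr_ge0 ?expR_ge0 // subr_ge0 cg.
rewrite subr_ge0 /h mulr0 expR0 mulr1 => h0T.
apply: le_trans (ler_wpM2r (expR_ge0 _) h0T) _.
by rewrite -mulrA -expRD mulNr addNr expR0 mulr1.
Qed.

(** Gronwall for minus the sum of the squares, which starts at 0 and therefore stays nonnegative. *)
Lemma gronwall_zero (I : finType) (f df : I -> R -> R) (C T : R) :
  0 <= T -> 0 <= C ->
  (forall i (t : R), is_derive t 1 (f i) (df i t)) ->
  (forall i, f i 0 = 0) ->
  (forall i t, 0 <= t <= T -> `|df i t| <= C * \sum_j `|f j t|) ->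
  forall i, f i T = 0.
Proof.
move=> T0 C0 fdf f0 dfC.
pose g (t : R) := - \sum_i f i t ^+ 2.
pose dg (t : R) := - \sum_i 2 * f i t * df i t.
have gdg (t : R) : is_derive t 1 g (dg t).
  apply: is_deriveN; apply: is_derive_bigsum => i.
  apply: is_derive_eq; rewrite /GRing.scale /=; ring.
have := @gronwall g dg (2 * C * #|I|%:R) T T0 gdg.
have -> : g 0 = 0.
  by rewrite /g big1 ?oppr0 // => i _; rewrite f0 expr0n.
rewrite mul0r oppr_ge0 => H i.
have : \sum_i f i T ^+ 2 <= 0.
  apply: H => t tT; rewrite /g /dg mulrN lerN2.
  pose s := \sum_j `|f j t|.
  (* The hypothesis on [df] bounds the derivative by [2 * C * s ^+ 2]; Cauchy-Schwarz turns [s ^+ 2]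
     into the sum of squares at the price of [#|I|]. *)
  apply: (@le_trans _ _ (2 * C * s ^+ 2)).
    rewrite expr2 /s mulr_suml mulr_sumr; apply: ler_sum => j _.
    have -> : 2 * C * (`|f j t| * s) = 2 * `|f j t| * (C * s) by ring.
    apply: le_trans (ler_norm _) _; rewrite !normrM (ger0_norm (_ : 0 <= 2)) //.
    by rewrite ler_wpM2l ?mulr_ge0 // dfC.
  rewrite -[X in _ <= X]mulrA ler_wpM2l ?mulr_ge0 //.
  apply: le_trans (sqr_sum_le _) _.
  by under eq_bigr do rewrite real_normK ?num_real //.
move=> le0; apply/eqP; rewrite -sqrf_eq0.
move: le0; rewrite le_eqVlt ltNge sumr_ge0 ?orbF /= => [|j _]; last first.
  exact: sqr_ge0.
rewrite psumr_eq0 => [/allP/(_ i (mem_index_enum _))|j _] //.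
exact: sqr_ge0.
Qed.
End Gronwall.

(** * Diagonality of the flow *)

Section Close.
Variables (R : realType) (d : nat).
Implicit Types (C e : R) (X Y : 'M[R]_d).

(** One constant is both a bound on the entries and a Lipschitz factor for the deviation [e], which
    makes the relation stable under products. *)
Definition mx_close C e X Y := forall a b,
  [/\ `|X a b| <= C, `|Y a b| <= C & `|X a b - Y a b| <= C * e].

Lemma mx_close_mulmx C1 C2 e X X' Y Y' : 0 <= C1 -> 0 <= C2 -> 0 <= e ->
  mx_close C1 e X X' -> mx_close C2 e Y Y' ->
  mx_close (d%:R * (2 * C1 * C2)) e (X *m Y) (X' *m Y').
Proof.
move=> C1_ge0 C2_ge0 e_ge0 XX' YY' a b.
have C_ge0 : 0 <= C1 * C2 by rewrite mulr_ge0.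
have sum_le (F : 'I_d -> R) c :
    (forall k, `|F k| <= c) -> `|\sum_k F k| <= d%:R * c.
  move=> Fc; apply: le_trans (ler_norm_sum _ _ _) _.
  apply: le_trans (ler_sum _ (fun k _ => Fc k)) _.
  by rewrite sumr_const card_ord mulr_natl.
split; rewrite !mxE.
- apply: sum_le => k; have [Xk _ _] := XX' a k; have [Yk _ _] := YY' k b.
  by rewrite normrM; apply: le_trans (ler_pM _ _ Xk Yk) _ => //; lra.
- apply: sum_le => k; have [_ Xk _] := XX' a k; have [_ Yk _] := YY' k b.
  by rewrite normrM; apply: le_trans (ler_pM _ _ Xk Yk) _ => //; lra.
rewrite -sumrB -mulrA; apply: sum_le => k.
have [_ Xk Xe] := XX' a k; have [Yk _ Ye] := YY' k b.
have -> : X a k * Y k b - X' a k * Y' k b =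
  (X a k - X' a k) * Y k b + X' a k * (Y k b - Y' k b) by ring.
apply: le_trans (ler_normD _ _) _; rewrite !normrM.
have -> : 2 * C1 * C2 * e = C1 * e * C2 + C1 * (C2 * e) by ring.
by rewrite lerD // ler_pM.
Qed.

Lemma mx_close_tr C e X Y : mx_close C e X Y -> mx_close C e X^T Y^T.
Proof. by move=> XY a b; rewrite !mxE. Qed.

Lemma mx_close_refl C e X : 0 <= C -> 0 <= e ->
  (forall a b, `|X a b| <= C) -> mx_close C e X X.
Proof. by move=> C0 e0 XC a b; rewrite subrr normr0 mulr_ge0. Qed.

(** The constant is chosen before [e], [U] and [V], so it is uniform in time once the factors are
    bounded. *)
Lemma mx_close_chain N (s : seq 'I_N) C : 0 <= C ->
  exists2 C', 0 <= C' & forall e (U V : 'I_N -> 'M[R]_d), 0 <= e ->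
    (forall j, mx_close C e (U j) (V j)) ->
    mx_close C' e (chain s U) (chain s V).
Proof.
move=> C_ge0; elim: s => [|j s [C' C'_ge0 IHs]].
  exists 1 => // e U V e_ge0 _; rewrite /chain !big_nil.
  apply: mx_close_refl => // a b.
  by rewrite mxE; case: eqP => _; rewrite ?normr1 ?normr0.
exists (d%:R * (2 * C * C')); first by rewrite !mulr_ge0.
move=> e U V e_ge0 UV; rewrite !chain_cons.
by apply: mx_close_mulmx => //; exact: IHs.
Qed.

Lemma chain_diag N (s : seq 'I_N) (v : 'rV[R]_d) :
  chain s (fun=> diag_mx v) = diag_mx (\row_a v 0 a ^+ size s).
Proof.
elim: s => [|j s IHs].
  rewrite /chain big_nil -diag_const_mx; congr diag_mx.
  by apply/rowP => a; rewrite !mxE.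
rewrite chain_cons IHs mulmx_diag; congr diag_mx.
by apply/rowP => a; rewrite !mxE exprS.
Qed.

End Close.

Lemma bounded_family (R : realType) (I : finType) (f : I -> R -> R) T :
  0 <= T ->
  (forall i, continuous (f i)) ->
  exists2 M, 0 <= M & forall i t, 0 <= t <= T -> `|f i t| <= M.
Proof.
move=> T_ge0 f_cont; pose g (t : R) := \sum_i `|f i t|.
have g_cont : continuous g.
  apply: continuous_big => [|i _ t]; first exact: add_continuous.
  by apply: cvg_norm; exact: f_cont.
have [c _ cP] := EVT_max T_ge0 (continuous_subspaceT g_cont).
exists (g c); first by rewrite sumr_ge0.
move=> i t tT; apply: le_trans (cP t _); last by rewrite in_itv.
by rewrite /g (bigD1 i) //= lerDl sumr_ge0.
Qed.

(* [U s j] is the factor [W_(j+1)] at time [s ^+ 2] in the diagonalizing basis.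
   The actual [mu s] depends on [U s]; it is treated here as a given function of
   time, for which diagonal families of equal factors are an invariant subspace
   of the flow. *)
Section DiagonalFlow.
Variables (R : realType) (d N : nat) (j0 : 'I_N).
Variables (U : R -> 'I_N -> 'M[R]_d) (mu : R -> 'rV[R]_d) (alpha : R).
Hypothesis N_gt1 : (1 < N)%N.
Hypothesis alpha_gt0 : 0 < alpha.
Hypothesis U0 : forall j, U 0 j = alpha%:M.
Hypothesis UN : forall s, U (- s) = U s.
Hypothesis mu_bounded : forall M, 0 <= M -> exists2 C, 0 <= C &
  forall s, (forall j a b, `|U s j a b| <= M) -> forall a, `|mu s 0 a| <= C.
Let G s (l : seq 'I_N * seq 'I_N) :=
  (chain l.1 (U s))^T *m diag_mx (mu s) *m (chain l.2 (U s))^T.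
Hypothesis U_flow : forall j, exists l : seq 'I_N * seq 'I_N,
  (size l.1 + size l.2).+1 = N /\
  forall (s : R) a b, is_derive s 1 (fun t => U t j a b) (2 * s * G s l a b).

Let u s := \row_a U s j0 a a.

Lemma flow_bounded T : 0 <= T ->
  exists2 M, 0 <= M & forall s, 0 <= s <= T -> forall j a b, `|U s j a b| <= M.
Proof.
move=> T_ge0.
have [|M M_ge0 MP] := @bounded_family R _
    (fun (x : 'I_N * 'I_d * 'I_d) s => U s x.1.1 x.1.2 x.2) _ T_ge0.
  move=> [[j a] b] /=; have [l [_ Ul]] := U_flow j.
  exact: is_derive_continuous (fun s => Ul s a b).
by exists M => // s sT j a b; exact: (MP (j, a, b)).
Qed.

Lemma flow_diag_ge0 s : 0 <= s -> forall j, U s j = diag_mx (u s).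
Proof.
move=> s_ge0 j; have [L Lflow] := choice U_flow.
(* [2 * t *: H t] is the common velocity of factors all equal to
   [diag_mx (u t)]; Gronwall applies to the deviation [f] from that family. *)
pose H t := diag_mx (\row_a (mu t 0 a * u t 0 a ^+ N.-1)).
pose f (x : 'I_N * 'I_d * 'I_d) t :=
  U t x.1.1 x.1.2 x.2 - (diag_mx (u t)) x.1.2 x.2.
pose df (x : 'I_N * 'I_d * 'I_d) t := 2 * t * G t (L x.1.1) x.1.2 x.2 -
   (2 * t * G t (L j0) x.1.2 x.1.2) *+ (x.1.2 == x.2).
pose e t := \sum_x `|f x t|.
have e_ge0 t : 0 <= e t by rewrite sumr_ge0.
have [M M_ge0 MP] := flow_bounded s_ge0.
have [K K_ge0 KP] := mu_bounded M_ge0.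
(* [G t (L i)] and [H t] are the same polynomial expression, in the actual factors and in
   [diag_mx (u t)] respectively, so on a bounded time interval their difference is Lipschitz in the
   deviation. *)
have close_G i : exists C, 0 <= C /\
    forall t, 0 <= t <= s -> mx_close C (e t) (G t (L i)) (H t).
  have [sizeL _] := Lflow i.
  (* The added 1 serves the Lipschitz clause of [mx_close]: a deviation, being one of the terms of
     [e t], is at most [1 * e t]. *)
  have M1_ge0 : 0 <= M + 1 by rewrite addr_ge0.
  have [C1 C1_ge0 C1P] := mx_close_chain d (L i).1 M1_ge0.
  have [C2 C2_ge0 C2P] := mx_close_chain d (L i).2 M1_ge0.
  exists (d%:R * (2 * (d%:R * (2 * C1 * K)) * C2)); split.
    by rewrite !mulr_ge0.
  move=> t ts; have tM := MP t ts.
  have HE : H t = (chain (L i).1 (fun=> diag_mx (u t)))^T *m diag_mx (mu t) *m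
      (chain (L i).2 (fun=> diag_mx (u t)))^T.
    rewrite !chain_diag !tr_diag_mx !mulmx_diag; congr diag_mx.
    apply/rowP => a; rewrite !mxE -(congr1 predn sizeL) /= exprD; ring.
  have UD k : mx_close (M + 1) (e t) (U t k) (diag_mx (u t)).
    move=> a b; split; first by rewrite (le_trans (tM k a b)) // lerDl.
      rewrite !mxE; case: eqP => _; rewrite ?mulr0n ?normr0 // mulr1n.
      by rewrite (le_trans (tM _ _ _)) // lerDl.
    apply: (@le_trans _ _ (1 * e t)); last by rewrite ler_wpM2r // lerDr.
    by rewrite mul1r /e (bigD1 (k, a, b)) //= lerDl sumr_ge0.
  rewrite HE; apply: mx_close_mulmx => //; first by rewrite !mulr_ge0.
    apply: mx_close_mulmx => //; first by apply/mx_close_tr/C1P.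
    apply: mx_close_refl => // a b; rewrite mxE.
    by case: eqP => _; rewrite ?mulr0n ?normr0 // mulr1n KP.
  by apply/mx_close_tr/C2P.
have [C CP] := choice close_G.
have C_ge0 i : 0 <= C i by have [] := CP i.
have C_le i : C i <= \sum_k C k by rewrite (bigD1 i) //= lerDl sumr_ge0.
suff f0 x : f x s = 0.
  apply/matrixP => a b; apply/eqP; rewrite -subr_eq0.
  by apply/eqP; exact: (f0 (j, a, b)).
(* [df] compares two velocities, each within a constant times [e t] of the common one; hence the sum
   of the constants appears twice. *)
apply: (@gronwall_zero R _ f df (2 * s * (\sum_k C k + \sum_k C k))) => //.
- by rewrite !mulr_ge0 // addr_ge0 // sumr_ge0.
- move=> [[i a] b] t; have [_ Ui] := Lflow i; have [_ Uj0] := Lflow j0.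
  have -> : f (i, a, b) =
      (fun t => U t i a b) - (a == b)%:R *: (fun t => U t j0 a a).
    by apply: funext => r; rewrite /f /= !mxE -[in LHS]mulr_natl.
  have {}Ui := Ui t a b; have {}Uj0 := Uj0 t a a.
  have -> : df (i, a, b) t =
      2 * t * G t (L i) a b - (a == b)%:R *: (2 * t * G t (L j0) a a).
    by rewrite /df /= -[X in _ - X = _]mulr_natl.
  exact: is_deriveB Ui (is_deriveZ (a == b)%:R Uj0).
- move=> [[i a] b]; rewrite /f !mxE !U0 !mxE eqxx mulr1n.
  exact: subrr.
- move=> [[i a] b] t ts; have /andP[t_ge0 t_le] := ts.
  have [_ /(_ t ts a b) [_ _ Gi]] := CP i.
  have [_ /(_ t ts a a) [_ _ Gj0]] := CP j0.
  have -> : df (i, a, b) t = 2 * t * ((G t (L i) a b - H t a b) -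
      (G t (L j0) a a - H t a a) *+ (a == b)).
    rewrite /df /H /=; case: eqP => [->|/eqP ab].
      by rewrite !mulr1n; ring.
    by rewrite !mulr0n [X in _ - X - _]mxE (negPf ab) mulr0n !subr0.
  rewrite normrM (ger0_norm (_ : 0 <= 2 * t)) ?mulr_ge0 // -!mulrA.
  rewrite ler_wpM2l // ler_pM //.
  apply: le_trans (ler_normB _ _) _; rewrite mulrDl lerD //.
    by apply: le_trans Gi _; rewrite ler_wpM2r.
  case: eqP => _; rewrite ?mulr0n ?mulr1n ?normr0.
    by apply: le_trans Gj0 _; rewrite ler_wpM2r.
  by rewrite mulr_ge0 // sumr_ge0.
Qed.

Lemma flow_diag s j : U s j = diag_mx (u s).
Proof.
have [s_ge0|s_lt0] := leP 0 s; first exact: flow_diag_ge0.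
have sN : 0 <= - s by rewrite oppr_ge0 ltW.
have uE : u s = u (- s) by rewrite /u UN.
by rewrite -UN uE; exact: flow_diag_ge0.
Qed.

Lemma flow_diag_derive a (s : R) :
  is_derive s 1 (fun t => u t 0 a) (2 * s * (mu s 0 a * u s 0 a ^+ N.-1)).
Proof.
have [l [sizel Ul]] := U_flow j0.
have -> : (fun t => u t 0 a) = (fun t => U t j0 a a).
  by apply: funext => t; rewrite mxE.
apply: (is_derive_eq (Ul s a a)); congr (_ * _).
rewrite /G -(congr1 predn sizel) /=.
have -> : U s = (fun=> diag_mx (u s)) by apply: funext => j; exact: flow_diag.
rewrite !chain_diag !tr_diag_mx !mulmx_diag !mxE eqxx mulr1n exprD; ring.
Qed.

(** The derivative of [u ^+ 2] is [u ^+ 2] times a factor bounded on compact intervals, so Gronwall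
    keeps [u] away from 0 at finite times; by the intermediate value theorem it keeps the sign of
    [alpha]. *)
Lemma flow_diag_gt0 a s : 0 < u s 0 a.
Proof.
wlog s_ge0 : s / 0 <= s => [H|].
  have [/H//|s_lt0] := leP 0 s.
  have -> : u s = u (- s) by rewrite /u UN.
  by apply: H; rewrite oppr_ge0 ltW.
have u0 : u 0 0 a = alpha by rewrite !mxE U0 mxE eqxx mulr1n.
have neq0 T : 0 <= T -> u T 0 a != 0.
  move=> T_ge0.
  have [M M_ge0 MP] := flow_bounded T_ge0.
  have [K K_ge0 KP] := mu_bounded M_ge0.
  pose g t := u t 0 a ^+ 2.
  pose dg t := 4 * t * mu t 0 a * u t 0 a ^+ N.-2 * g t.
  have gdg (t : R) : is_derive t 1 g (dg t).
    have ut := flow_diag_derive a t.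
    apply: is_derive_eq; rewrite /GRing.scale /= /dg /g.
    have -> : N.-1 = N.-2.+1 by case: N N_gt1 => [|[]].
    rewrite exprS; ring.
  have uM t : 0 <= t <= T -> `|u t 0 a| <= M by move=> tT; rewrite mxE MP.
  have := @gronwall R g dg (- (4 * T * K * M ^+ N.-2)) T T_ge0 gdg.
  rewrite /g u0 => H; rewrite -sqrf_eq0 gt_eqF //.
  apply: lt_le_trans (H _) => //.
    by rewrite mulr_gt0 ?exprn_gt0 ?expR_gt0.
  move=> t tT; rewrite /dg /g ler_wpM2r ?sqr_ge0 //.
  rewrite lerNl; apply: le_trans (ler_norm _) _; rewrite normrN !normrM normrX.
  have /andP[t_ge0 t_le] := tT.
  rewrite (ger0_norm t_ge0) (ger0_norm (_ : 0 <= 4)) //.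
  rewrite ler_pM ?mulr_ge0 ?exprn_ge0 //.
    by rewrite ler_pM ?mulr_ge0 // ?ler_wpM2l //; apply: KP => j b c; exact: MP.
  by rewrite lerXn2r ?nnegrE // uM.
rewrite ltNge; apply/negP => us.
have uc : continuous (fun t => u t 0 a).
  exact: is_derive_continuous (flow_diag_derive a).
have [|c] := @IVT R _ 0 s 0 s_ge0 (continuous_subspaceT uc).
  by rewrite u0 ge_min us orbT le_max (ltW alpha_gt0).
rewrite in_itv /= => /andP[c_ge0 _] /eqP; apply/negP; exact: neq0.
Qed.

End DiagonalFlow.

(** * Conservation law and limit *)

Section Conserved.
Variables (R : realType) (d n : nat) (u mu : R -> 'rV[R]_d).
Hypothesis u_gt0 : forall a s, 0 < u s 0 a.
Hypothesis u_flow : forall a (s : R),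
  is_derive s 1 (fun t => u t 0 a) (2 * s * (mu s 0 a * u s 0 a ^+ n.+2)).

(** Differentiating the inverse power [n.+1] of [u] cancels the power [n.+2] in the velocity,
    leaving a multiple of [mu] with a factor common to all coordinates. *)
Lemma flow_conserved (q : 'I_d -> R) : (forall s, \sum_a q a * mu s 0 a = 0) ->
  forall s t, \sum_a q a * (u s 0 a ^+ n.+1)^-1 =
    \sum_a q a * (u t 0 a ^+ n.+1)^-1.
Proof.
move=> q_mu s t.
apply: (@is_derive_0_is_cst R
  (fun s => \sum_a q a * (u s 0 a ^+ n.+1)^-1)) => r.
have sum0 : \sum_a q a *: (- (2 * r * n.+1%:R) * mu r 0 a) = 0.
  transitivity (- (2 * r * n.+1%:R) * \sum_a q a * mu r 0 a).
    by rewrite mulr_sumr; apply: eq_bigr => a _; rewrite /GRing.scale /= mulrCA.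
  by rewrite q_mu mulr0.
suff : is_derive (r : R) 1 (fun s : R => \sum_a q a * (u s 0 a ^+ n.+1)^-1)
  (\sum_a q a *: (- (2 * r * n.+1%:R) * mu r 0 a)) by rewrite sum0.
apply: is_derive_bigsum => a.
have ur := u_flow a r; have u0 : u r 0 a != 0 by rewrite gt_eqF.
have un : is_derive r 1 (fun t => u t 0 a ^+ n.+1)
    (n.+1%:R * u r 0 a ^+ n * (2 * r * (mu r 0 a * u r 0 a ^+ n.+2))).
  have -> : (fun t => u t 0 a ^+ n.+1) = (fun t => u t 0 a) ^+ n.+1.
    by rewrite exprfctE.
  exact: (is_derive_eq (is_deriveX n.+1 ur)).
have uV : is_derive r 1 (fun t => (u t 0 a ^+ n.+1)^-1)
    (- (2 * r * n.+1%:R) * mu r 0 a).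
  apply: (is_derive_eq (is_deriveV _ un)); first by rewrite expf_neq0.
  rewrite /GRing.scale /= -natr1 !exprS; field.
  by rewrite u0 expf_neq0.
exact: (is_deriveZ (q a) uV).
Qed.
End Conserved.

Lemma sum_le_of_weights (R : realType) (d n N : nat) (z w : 'I_d -> R)
    (v : R -> R -> 'I_d -> R) (vinf : R -> 'I_d -> R) :
  (forall k, 0 <= z k) -> (forall k, 0 <= w k) ->
  (forall alpha s k, 0 < alpha -> 0 < v alpha s k) ->
  (forall alpha s, 0 < alpha ->
    \sum_k (z k - w k) * (alpha / v alpha s k) ^+ n.+1 = \sum_k (z k - w k)) ->
  (forall alpha k, 0 < alpha ->
    v alpha s k ^+ N.+1 @[s --> +oo] --> vinf alpha k) ->
  (forall k, vinf alpha k @[alpha --> 0^'+] --> w k) ->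
  \sum_k w k <= \sum_k z k.
Proof.
move=> z_ge0 w_ge0 v_gt0 vE vN vinf_w.
rewrite -subr_ge0 -sumrB; set S := \sum_i _.
(* A lower bound for [v] at late times when [w k > 0]: there [v ^+ N.+1] exceeds [w k / 2], and
   either [v] is at least 1 or it dominates its own power, so no root is taken. The value at
   [w k = 0] only keeps [del] positive. *)
pose del k := if w k == 0 then 1 else Num.min 1 (w k / 2).
have del_gt0 k : 0 < del k.
  rewrite /del; case: eqP => // /eqP wk; rewrite lt_min ltr01 /=.
  by rewrite divr_gt0 // lt0r wk w_ge0.
pose C := \sum_k `|z k - w k| / del k.
have C_ge0 : 0 <= C by rewrite sumr_ge0 // => k _; rewrite divr_ge0 // ltW.
have del_v k : \forall alpha \near (0 : R)^'+, \forall s \near +oo,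
    w k != 0 -> del k <= v alpha s k.
  have [wk|wk] := eqVneq (w k) 0; first by near=> alpha; near=> s.
  have wk_gt0 : 0 < w k by rewrite lt0r wk w_ge0.
  near=> alpha.
  have alpha_gt0 : 0 < alpha by near: alpha; exact: nbhs_right_gt.
  have vinf_gt : w k / 2 < vinf alpha k.
    near: alpha; apply: (cvgr_gt _ (vinf_w k)).
    by rewrite ltr_pdivrMr // ltr_pMr // ltr1n.
  near=> s => _.
  have vs : w k / 2 < v alpha s k ^+ N.+1.
    by near: s; exact: (cvgr_gt _ (vN alpha k alpha_gt0)).
  rewrite /del (negPf wk); have [v1|v1] := leP 1 (v alpha s k).
    by rewrite ge_min v1.
  rewrite ge_min; apply/orP; right; apply: le_trans (ltW vs) _.
  rewrite exprS ler_piMr ?exprn_ile1 // ltW //; exact: v_gt0.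
rewrite leNgt; apply/negP => S_lt0.
(* First [alpha] is fixed, then a late time [s]. The bound by [- S / (C + 1)] will contradict
   [- (alpha * C) <= S]; adding 1 keeps the denominator positive. *)
have [alpha [alpha_gt0 alpha_del alphaS near_s]] : exists alpha, [/\ 0 < alpha,
    forall k, alpha <= del k, alpha < - S / (C + 1) &
    \forall s \near +oo, forall k, w k != 0 -> del k <= v alpha s k].
  near (0 : R)^'+ => alpha; exists alpha; split.
  - by near: alpha; exact: nbhs_right_gt.
  - near: alpha; apply: filter_forall => k; exact: nbhs_right_le.
  - near: alpha; apply: nbhs_right_lt; rewrite divr_gt0 ?oppr_gt0 //.
    by rewrite ltr_wpDl.
  - have : forall k, \forall s \near +oo, w k != 0 -> del k <= v alpha s k.
      by near: alpha; apply: filter_forall => k; exact: del_v.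
    exact: filter_forall.
have [s sP] := filter_ex near_s.
(* Terms with [w k = 0] are nonnegative. In the others [alpha <= del k <= v], so the power of
   [alpha / v] is at most [alpha / v], hence at most [alpha / del k]. *)
have : - (alpha * C) <= S.
  rewrite /S -(vE alpha s alpha_gt0) /C mulr_sumr -sumrN.
  apply: ler_sum => k _; set q := z k - w k.
  have vk := v_gt0 alpha s k alpha_gt0.
  have [wk|wk] := eqVneq (w k) 0.
    apply: (@le_trans _ _ 0).
      by rewrite oppr_le0 !mulr_ge0 ?invr_ge0 // ltW.
    by rewrite /q wk subr0 mulr_ge0 // exprn_ge0 // divr_ge0 // ltW.
  have del_vk := sP k wk.
  apply: (@le_trans _ _ (- (`|q| * (alpha / v alpha s k) ^+ n.+1))).
    rewrite lerN2 mulrCA ler_wpM2l //.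
    apply: (@le_trans _ _ (alpha / v alpha s k)).
      have av_ge0 : 0 <= alpha / v alpha s k by rewrite divr_ge0 // ltW.
      rewrite exprS ler_piMr // exprn_ile1 //.
      by rewrite ler_pdivrMr // mul1r (le_trans (alpha_del k)).
    by rewrite ler_pM2l // lef_pV2 ?posrE.
  rewrite -mulNr ler_wpM2r //; first by rewrite exprn_ge0 // divr_ge0 // ltW.
  by rewrite lerNl -normrN ler_norm.
apply/negP; rewrite -ltNge ltrNr.
move: alphaS; rewrite ltr_pdivlMr ?ltr_wpDl //; apply: le_lt_trans.
by rewrite ler_pM2l // lerDl.
Unshelve. all: end_near. Qed.

(** * The loss in the common eigenbasis *)

Section CommutingLoss.
Variables (R : realType) (d m N : nat) (A : 'I_m -> 'M[R]_d) (y : 'I_m -> R).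
Hypothesis A_sym : forall i, (A i)^T = A i.
Variables (P : 'M[R]_d) (L : 'I_m -> 'rV[R]_d).
Hypothesis P1 : P *m P^T = 1%:M.
Hypothesis AL : forall i, P *m A i *m P^T = diag_mx (L i).

Let P2 : P^T *m P = 1%:M := mulmx1C P1.

(** The eigenvalues of minus the gradient of the loss at [V], in the basis [P]; along the flow this
    is the vector [mu]. *)
Definition residual_spectrum (V : 'M[R]_d) : 'rV[R]_d :=
  \row_a \sum_i (y i - mxinner (A i) V) * L i 0 a.

Lemma conj_mulmx (X Y : 'M[R]_d) :
  P *m (X *m Y) *m P^T = (P *m X *m P^T) *m (P *m Y *m P^T).
Proof. by rewrite !mulmxA -[P *m X *m P^T *m P]mulmxA P2 mulmx1. Qed.

Lemma conj_chain (s : seq 'I_N) (W : 'I_N -> 'M[R]_d) :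
  P *m chain s W *m P^T = chain s (fun j => P *m W j *m P^T).
Proof.
elim: s => [|j s IHs]; first by rewrite /chain !big_nil mulmx1.
by rewrite !chain_cons conj_mulmx IHs.
Qed.

Lemma mxinner_conj i (V : 'M[R]_d) :
  mxinner (A i) V = \sum_k L i 0 k * (P *m V *m P^T) k k.
Proof.
rewrite /mxinner A_sym -(mxtrace_orthogonal_conj _ P1) conj_mulmx AL.
by rewrite mul_diag_mx; apply: eq_bigr => k _; rewrite mxE.
Qed.

Lemma loss_grad_conj (V : 'M[R]_d) :
  P *m (- loss_grad A y V) *m P^T = diag_mx (residual_spectrum V).
Proof.
rewrite /loss_grad opprK mulmx_sumr mulmx_suml.
transitivity (\sum_i (y i - mxinner (A i) V) *: diag_mx (L i)).
  by apply: eq_bigr => i _; rewrite -scalemxAr -scalemxAl AL.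
apply/matrixP => a b; rewrite summxE !mxE -sumrMnl.
by apply: eq_bigr => i _; rewrite !mxE mulrnAr.
Qed.

Lemma residual_spectrum_bounded M : 0 <= M -> exists2 C, 0 <= C &
  forall W : 'I_N -> 'M[R]_d, (forall j a b, `|(P *m W j *m P^T) a b| <= M) ->
  forall a, `|residual_spectrum (deep_product W) 0 a| <= C.
Proof.
move=> M_ge0; pose s := [seq rev_ord i | i <- index_enum 'I_N].
have [K K_ge0 KP] := mx_close_chain d s M_ge0.
pose r i := `|y i| + \sum_k `|L i 0 k| * K.
have r_ge0 i : 0 <= r i.
  by rewrite addr_ge0 // sumr_ge0 // => k _; rewrite mulr_ge0.
exists (\sum_a \sum_i r i * `|L i 0 a|).
  by rewrite !sumr_ge0 // => a _; rewrite sumr_ge0 // => i _; rewrite mulr_ge0.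
move=> W WM a; rewrite mxE (bigD1 a) //= ler_wpDr //.
  by rewrite !sumr_ge0 // => b _; rewrite sumr_ge0 // => i _; rewrite mulr_ge0.
apply: le_trans (ler_norm_sum _ _ _) _; apply: ler_sum => i _.
rewrite normrM ler_wpM2r //; apply: le_trans (ler_normB _ _) _.
rewrite lerD2l mxinner_conj; apply: le_trans (ler_norm_sum _ _ _) _.
apply: ler_sum => k _; rewrite normrM ler_wpM2l //.
rewrite deep_productE conj_chain.
pose U j := P *m W j *m P^T.
(* Closeness with deviation 0 is used for its entrywise bound on the product. *)
have UU j : mx_close M 0 (U j) (U j) by apply: mx_close_refl => //; exact: WM.
by have [] := KP 0 U U (lexx 0) UU k k.
Qed.

(** The residual spectrum at any point combines the spectra [L i], and pairing [L i] with a
    conjugated diagonal computes the measurement [mxinner (A i)], on which [V] and [V'] agree. *)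
Lemma residual_spectrum_orthogonal V V' V'' :
  (forall i, mxinner (A i) V = mxinner (A i) V') ->
  \sum_a ((P *m V *m P^T) a a - (P *m V' *m P^T) a a) *
    residual_spectrum V'' 0 a = 0.
Proof.
move=> VV'; under eq_bigr do rewrite [X in _ * X]mxE mulr_sumr.
rewrite exchange_big big1 // => i _.
transitivity ((y i - mxinner (A i) V'') * (mxinner (A i) V - mxinner (A i) V')).
  rewrite [mxinner (A i) V]mxinner_conj [mxinner (A i) V']mxinner_conj.
  by rewrite -sumrB mulr_sumr; apply: eq_bigr => a _; ring.
by rewrite VV' subrr mulr0.
Qed.

Lemma loss_eq0 V : loss A y V = 0 -> forall i, mxinner (A i) V = y i.
Proof.
move=> /eqP; rewrite mulf_eq0 invr_eq0 pnatr_eq0 /=.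
rewrite psumr_eq0 => [/allP H i|i _]; last exact: sqr_ge0.
have := H i (mem_index_enum _); rewrite sqrf_eq0 subr_eq0 => /eqP.
by move=> ->.
Qed.

(** Orthogonal conjugation respects products and transposes, so the flow keeps its form in the new
    basis while the gradient becomes diagonal. *)
Lemma gradient_flow_conj (alpha : R) (W : R -> 'I_N -> 'M[R]_d) (j : 'I_N) :
  gradient_flow (deep_loss (loss A y)) (fun=> alpha%:M) W ->
  exists l : seq 'I_N * seq 'I_N, (size l.1 + size l.2).+1 = N /\
  forall (s : R) a b, is_derive s 1 (fun t => (P *m W (t ^+ 2) j *m P^T) a b)
    (2 * s * ((chain l.1 (fun k => P *m W (s ^+ 2) k *m P^T))^T *m
      diag_mx (residual_spectrum (deep_product (W (s ^+ 2)))) *m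
      (chain l.2 (fun k => P *m W (s ^+ 2) k *m P^T))^T) a b).
Proof.
move=> [_ Wflow]; have [s1 [s2 [sN sP]]] := deep_product_split j.
exists (s1, s2); split=> // s a b /=.
have := is_derive_conj_sqr P a b (Wflow (s ^+ 2) (sqr_ge0 s) j).
rewrite (block_gradE A y (sP R d (W (s ^+ 2)))).
rewrite -!conj_chain -loss_grad_conj !trmx_mul !trmxK.
by rewrite -mulNmx -mulmxN !conj_mulmx !mulmxA.
Qed.

End CommutingLoss.

(** Carries limits in the original time over to squared time. *)
Lemma sqr_cvg_pinfty (R : realType) : (s ^+ 2 : R) @[s --> +oo] --> +oo.
Proof.
apply/cvgryPge => M; near=> s.
have s_ge1 : 1 <= s by near: s; exact: nbhs_pinfty_ge.
have sM : M <= s by near: s; exact: (nbhs_pinfty_ge (num_real M)).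
by rewrite (le_trans sM) // expr2 ler_peMl // (le_trans ler01).
Unshelve. all: end_near. Qed.

(** * Comparison of traces along the flow *)

Theorem theorem2 (R : realType) (d m N : nat) (hN : (3 <= N)%N)
    (A : 'I_m -> 'M[R]_d) (y : 'I_m -> R)
    (A_sym : forall i, (A i)^T = A i)
    (A_free : free [seq A i | i <- enum 'I_m])
    (A_comm : forall i j, comm_mx (A i) (A j))
    (W : R -> R -> 'I_N -> 'M[R]_d)
    (W_flow : forall alpha, 0 < alpha ->
       gradient_flow (deep_loss (loss A y)) (fun=> alpha%:M) (W alpha))
    (Winf : R -> 'M[R]_d)
    (W_lim : forall alpha, 0 < alpha ->
       deep_product (W alpha t) @[t --> +oo] --> Winf alpha)
    (Wbar : 'M[R]_d)
    (Winf_lim : Winf alpha @[alpha --> 0^'+] --> Wbar)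
    (Wbar_opt : argmin (psd (R:=R) (d:=d)) (loss A y) Wbar)
    (Wbar_loss : loss A y Wbar = 0) :
  argmin [set V | psd V /\ loss A y V = 0] (nuclear_norm (d:=d)) Wbar.
Proof.
have [Wbar_psd _] := Wbar_opt; split=> // V [V_psd V_loss].
have [P P1 /choice[L AL]] := sym_orthogonal_codiag A_sym A_comm.
rewrite !nuclear_norm_psd //.
rewrite -(mxtrace_orthogonal_conj Wbar P1) -(mxtrace_orthogonal_conj V P1).
case: N hN W W_flow W_lim => [|[|[|n]]] // _ W W_flow W_lim.
pose U alpha (s : R) j := P *m W alpha (s ^+ 2) j *m P^T.
pose mu alpha s := residual_spectrum A y L (deep_product (W alpha (s ^+ 2))).
pose u alpha s := \row_a U alpha s ord0 a a.
have U0 alpha : 0 < alpha -> forall j, U alpha 0 j = alpha%:M.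
  move=> /W_flow[W0 _] j; rewrite /U expr0n W0 /=.
  by rewrite mul_mx_scalar -scalemxAl P1 scale_scalar_mx mulr1.
have UN alpha s : U alpha (- s) = U alpha s by rewrite /U sqrrN.
have mu_bounded alpha M : 0 <= M -> exists2 C, 0 <= C & forall s,
    (forall j a b, `|U alpha s j a b| <= M) -> forall a, `|mu alpha s 0 a| <= C.
  move=> M_ge0.
  have [C C_ge0 CP] := residual_spectrum_bounded n.+3 y A_sym P1 AL M_ge0.
  by exists C => // s; exact: CP.
have U_flow alpha (alpha_gt0 : 0 < alpha) j :=
  gradient_flow_conj P1 AL j (W_flow alpha alpha_gt0).
have U_diag alpha : 0 < alpha -> forall s j, U alpha s j = diag_mx (u alpha s).
  move=> alpha_gt0; exact: (flow_diag ord0 (U0 _ alpha_gt0) (UN alpha)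
    (mu_bounded alpha) (U_flow _ alpha_gt0)).
have N_gt1 : (1 < n.+3)%N by [].
have u_gt0 alpha : 0 < alpha -> forall a s, 0 < u alpha s 0 a.
  move=> alpha_gt0.
  exact: (flow_diag_gt0 ord0 N_gt1 alpha_gt0 (U0 _ alpha_gt0) (UN alpha)
    (mu_bounded alpha) (U_flow _ alpha_gt0)).
have u_flow alpha : 0 < alpha -> forall a (s : R), is_derive s 1
    (fun t => u alpha t 0 a) (2 * s * (mu alpha s 0 a * u alpha s 0 a ^+ n.+2)).
  move=> alpha_gt0.
  exact: (flow_diag_derive ord0 (U0 _ alpha_gt0) (UN alpha)
    (mu_bounded alpha) (U_flow _ alpha_gt0)).
have u0 alpha : 0 < alpha -> forall a, u alpha 0 0 a = alpha.
  by move=> alpha_gt0 a; rewrite mxE U0 // mxE eqxx mulr1n.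
have prodE alpha s k : 0 < alpha ->
    (P *m deep_product (W alpha (s ^+ 2)) *m P^T) k k = u alpha s 0 k ^+ n.+3.
  move=> alpha_gt0; rewrite deep_productE (conj_chain P1) -/(U alpha s).
  have -> : U alpha s = (fun=> diag_mx (u alpha s)).
    by apply: funext => j; exact: U_diag.
  rewrite chain_diag mxE eqxx mulr1n mxE size_map.
  by rewrite [index_enum _]unlock -enumT size_enum_ord.
(* The depth is [n.+3]: passing [n.+2] makes the exponent in the limit the depth, while the weights
   carry the conserved exponent [n.+1], the depth minus 2. *)
apply: (@sum_le_of_weights R d n n.+2 (fun k => (P *m V *m P^T) k k)
  (fun k => (P *m Wbar *m P^T) k k) (fun alpha s k => u alpha s 0 k)
  (fun alpha k => (P *m Winf alpha *m P^T) k k)).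
- by move=> k; exact: psd_conj_diag_ge0.
- by move=> k; exact: psd_conj_diag_ge0.
- by move=> alpha s k alpha_gt0; exact: u_gt0.
- move=> alpha s alpha_gt0.
  pose q k := (P *m V *m P^T) k k - (P *m Wbar *m P^T) k k.
  have q_mu r : \sum_a q a * mu alpha r 0 a = 0.
    apply: (residual_spectrum_orthogonal y A_sym P1 AL) => i.
    by rewrite (loss_eq0 V_loss) (loss_eq0 Wbar_loss).
  (* Comparison with time 0, where every [u] equals [alpha]; multiplying by [alpha ^+ n.+1] makes
     the initial weights 1. *)
  have cons := flow_conserved (u_gt0 _ alpha_gt0) (u_flow _ alpha_gt0) q_mu s 0.
  transitivity (alpha ^+ n.+1 * \sum_a q a * (u alpha s 0 a ^+ n.+1)^-1).
    by rewrite mulr_sumr; apply: eq_bigr => k _; rewrite expr_div_n mulrCA.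
  rewrite cons mulr_sumr; apply: eq_bigr => k _.
  by rewrite u0 // mulrCA mulfV ?mulr1 // expf_neq0 // gt_eqF.
- move=> alpha k alpha_gt0.
  under eq_fun do rewrite -prodE //.
  have := cvg_comp _ _ (W_lim _ alpha_gt0)
    (@conj_entry_continuous R d P k k (Winf alpha)).
  exact: cvg_comp _ _ (@sqr_cvg_pinfty R).
- move=> k.
  exact: (cvg_comp _ _ Winf_lim (@conj_entry_continuous R d P k k Wbar)).
Qed.
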